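(* Let $x_0>2$ and let $x_1\ge \max(x_0,14)$. Let $\{b_i\}_{i=1}^N$ be a finite partition of the interval $[\log(x_0),\log(x_1)]$, with $b_1=\log(x_0)$ and $b_N=\log(x_1)$, and suppose that for each $i=1,\dots,N$ the number $\varepsilon_{\theta,num}(e^{b_i})$ is an admissible numerical bound for $E_\theta$, i.e. $E_\theta(x)\le \varepsilon_{\theta,num}(e^{b_i})$ for all $x\ge e^{b_i}$. Put $$S=\frac{x_0\log(x_1)}{\varepsilon_{\theta,num}(x_1)x_1\log(x_0)}\left|\frac{\pi(x_0)-\mathrm{Li}(x_0)}{x_0/\log(x_0)}-\frac{\theta(x_0)-x_0}{x_0}\right|+\frac{\log(x_1)}{\varepsilon_{\theta,num}(x_1)x_1}\sum_{i=1}^{N-1}\varepsilon_{\theta,num}(e^{b_i})\left(\mathrm{Li}(e^{b_{i+1}})-\mathrm{Li}(e^{b_i})+\frac{e^{b_i}}{b_i}-\frac{e^{b_{i+1}}}{b_{i+1}}\right).$$ For $x_1\le x_2\le x_1\log(x_1)$ define $$\mu_{num}(x_0,x_1,x_2)=S+\frac{\log(x_2)}{x_2}\left(\mathrm{Li}(x_2)-\frac{x_2}{\log(x_2)}-\mathrm{Li}(x_1)+\frac{x_1}{\log(x_1)}\right),$$ and for $x_2>x_1\log(x_1)$, including $x_2=\infty$, define $$\mu_{num}(x_0,x_1,x_2)=S+\frac{1}{\log(x_1)+\log(\log(x_1))-1}.$$ Then for all $x$ with $x_1\le x\le x_2$ (all $x\ge x_1$ if $x_2=\infty$), $$E_\pi(x)\le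 \varepsilon_{\theta,num}(x_1)\left(1+\mu_{num}(x_0,x_1,x_2)\right).$$
   Context: $\pi(x)$ is the number of primes $p\le x$; $\theta(x)=\sum_{p\le x}\log p$ (sum over primes); $\mathrm{Li}(x)=\int_2^x\frac{dt}{\log t}$. The error terms are $E_\pi(x)=\left|\frac{\pi(x)-\mathrm{Li}(x)}{x/\log x}\right|$ and $E_\theta(x)=\left|\frac{\theta(x)-x}{x}\right|$. Since $b_N=\log(x_1)$, $\varepsilon_{\theta,num}(x_1)$ means $\varepsilon_{\theta,num}(e^{b_N})$. *)

(* Defs.v *)
(* Stdlib reals with Coquelicot. *)
From Stdlib Require Import Reals ZArith Znumtheory List.
From Coquelicot Require Import Coquelicot.
Open Scope R_scope.

(* Int_part is the floor; for x < 1 the list is empty. *)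
Definition primes_upto (x : R) : list nat :=
  filter (fun n => if prime_dec (Z.of_nat n) then true else false)
         (seq 1 (Z.to_nat (Int_part x))).

Definition prime_pi (x : R) : R := INR (length (primes_upto x)).

Definition theta (x : R) : R :=
  fold_right Rplus 0 (map (fun p => ln (INR p)) (primes_upto x)).

Definition Li (x : R) : R := RInt (fun t => / ln t) 2 x.

Definition E_pi (x : R) : R := Rabs ((prime_pi x - Li x) / (x / ln x)).

Definition E_theta (x : R) : R := Rabs ((theta x - x) / x).

Definition admissible_num_bound (E : R -> R) (eps y : R) : Prop :=
  forall x : R, y <= x -> E x <= eps.

(* The points are b 1, ..., b N; values of b at other indices are irrelevant.
   Repeated points are allowed, as they contribute nothing to the sum below. *)
Definition is_partition (N : nat) (b : nat -> R) (u v : R) : Prop :=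
  (1 <= N)%nat /\ b 1%nat = u /\ b N = v /\
  (forall i : nat, (1 <= i < N)%nat -> b i <= b (i + 1)%nat).

(* sum_n_m a 1 (N - 1) is the empty sum when N = 1. *)
Definition S_num (eps : R -> R) (N : nat) (b : nat -> R) (x0 x1 : R) : R :=
  (x0 * ln x1) / (eps x1 * x1 * ln x0)
    * Rabs ((prime_pi x0 - Li x0) / (x0 / ln x0) - (theta x0 - x0) / x0)
  + ln x1 / (eps x1 * x1)
    * sum_n_m (fun i : nat =>
        eps (exp (b i))
        * (Li (exp (b (i + 1)%nat)) - Li (exp (b i))
           + exp (b i) / b i - exp (b (i + 1)%nat) / b (i + 1)%nat))
        1 (N - 1).

(* mu_num is only meaningful for x1 <= x2, so m_infty never occurs and
   real x2 is x2 itself in the first branch. *)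
Definition mu_num (eps : R -> R) (N : nat) (b : nat -> R)
    (x0 x1 : R) (x2 : Rbar) : R :=
  if Rbar_le_dec x2 (Finite (x1 * ln x1)) then
    S_num eps N b x0 x1
    + ln (real x2) / real x2
      * (Li (real x2) - real x2 / ln (real x2) - Li x1 + x1 / ln x1)
  else
    S_num eps N b x0 x1 + 1 / (ln x1 + ln (ln x1) - 1).

(* Main.v *)
Require Import Defs.
From Stdlib Require Import Reals ZArith Znumtheory List.
From Stdlib Require Import Lra Lia.
From Coquelicot Require Import Coquelicot.
Open Scope R_scope.

(** Write [J x = Li x - x / ln x], a primitive of [1 / ln^2].  Partial summation
    says that
      [pi x - Li x = W x + (theta x - x) / ln x],
    where [W = pi - theta / ln - J] ([abel_rest] below) has, in integrated form,
    derivative [(theta t - t) / (t ln^2 t)].  So wherever [E_theta <= eps] the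
    variation of [W] is at most [eps] times the increment of [J].  Summing over the
    partition of [[ln x0, ln x1]] and adding the stretch from [x1] to [x],
      [|pi x - Li x| <= |W x0| + sum_i eps_i (J (e^b_(i+1)) - J (e^b_i))
                        + eps_N (J x - J x1) + eps_N x / ln x].
    Dividing by [x / ln x], and using that [ln x / x] decreases beyond [e] on the
    first two terms, gives
      [E_pi x <= eps_N (1 + S + F x)] with [F x = (ln x / x) (J x - J x1)]
    ([E_pi_le_sum]).  The variation of [W] is obtained without any integral: the
    jumps of [pi] and [theta / ln] at a prime cancel, so on each [[n, n+1]],
    endpoints included, [W] agrees with a smooth function, to which the mean
    value theorem applies ([abel_rest_variation]).

    It remains to bound [F] on [[x1, x2]].  Its derivative has the sign of
      [H x = x / (ln x (ln x - 1)) - (J x - J x1)],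
    and [H] is decreasing, its derivative being [- 1 / (ln x (ln x - 1)^2)].  The
    crucial point is that [H y >= 0] at [y = x1 ln x1] ([J_gap_le_stationary]).
    Hence [F] increases up to [y], which settles [x2 <= y]
    ([tail_mass_le_at_later]).  Further, for the constant [c = 1 / (ln y - 1)] the
    function [c t / ln t - J t] has its minimum at [t = y], where
    [c y / ln y - (J y - J x1) = H y >= 0]; so [F <= c] everywhere
    ([tail_mass_le_const]), and [ln y = ln x1 + ln (ln x1)].

    For [H y >= 0], put [L = ln x1].  If [L <= e], bounding the integrand of
    [J y - J x1] by [1 / L^2] is enough.  Beyond [x1 = e^e], [H (x1 ln x1)] is a
    nondecreasing function of [x1]. *)

(** * Elementary calculus *)

Lemma nondecreasing_of_derive (f f' : R -> R) (a b : R) :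
  a <= b ->
  (forall t, a <= t <= b -> is_derive f t (f' t)) ->
  (forall t, a < t < b -> 0 <= f' t) ->
  f a <= f b.
Proof.
  intros Hab Hd Hp.
  destruct (Req_dec a b) as [->|Hne]; [lra|].
  destruct (MVT_cor2 f f' a b) as [c [Hc Hc']]; [lra| |].
  - intros c Hc. apply is_derive_Reals, Hd, Hc.
  - specialize (Hp c Hc'). nra.
Qed.

Lemma ln_pos (x : R) : 1 < x -> 0 < ln x.
Proof. intros H. rewrite <- ln_1. apply ln_increasing; lra. Qed.

Lemma ln_gt_1 (x : R) : 3 < x -> 1 < ln x.
Proof.
  intros H. rewrite <- (ln_exp 1). apply ln_increasing.
  - apply exp_pos.
  - pose proof exp_le_3. lra.
Qed.

Lemma ln_le_mono (x y : R) : 0 < x -> x <= y -> ln x <= ln y.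
Proof.
  intros Hx Hxy. destruct (Req_dec x y) as [->|]; [lra|].
  left. apply ln_increasing; lra.
Qed.

Lemma exp_le_mono (x y : R) : x <= y -> exp x <= exp y.
Proof. intros [H | ->]; [left; now apply exp_increasing | apply Rle_refl]. Qed.

(** * The primitive of 1 / ln^2 *)

(** Integrating [1 / ln] by parts from 2 shows that this is
    [RInt (fun t => 1 / (ln t)^2) 2 x] up to a constant; only its derivative and
    its increments matter. *)
Definition J (x : R) : R := Li x - x / ln x.

Lemma is_derive_Li (x : R) : 1 < x -> is_derive Li x (/ ln x).
Proof.
  intros Hx.
  assert (Hc : forall t, 1 < t -> continuous (fun t => / ln t) t).
  { intros t Ht. apply (ex_derive_continuous (fun t => / ln t)).
    auto_derive. pose proof (ln_pos t Ht). repeat split; lra. }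
  apply (is_derive_RInt (fun t => / ln t) Li 2 x); [|now apply Hc].
  apply (locally_interval _ x 1 p_infty); simpl; try easy.
  intros y Hy _. apply (RInt_correct (fun t => / ln t) 2 y).
  apply (ex_RInt_continuous (fun t => / ln t)). intros z Hz. apply Hc. apply Rlt_le_trans with (2 := proj1 Hz).
  now apply Rmin_glb_lt; [lra|].
Qed.

Lemma is_derive_J (x : R) : 1 < x -> is_derive J x (/ (ln x)^2).
Proof.
  intros Hx. pose proof (ln_pos x Hx) as Hl.
  assert (H : is_derive (fun t => t / ln t) x (/ ln x - / (ln x)^2)).
  { auto_derive; [repeat split; lra|]. field. split; lra. }
  replace (/ (ln x)^2) with (minus (/ ln x) (/ ln x - / (ln x)^2))
    by (unfold minus, plus, opp; simpl; ring).
  apply @is_derive_minus; [now apply is_derive_Li | exact H].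
Qed.

Lemma J_le (a b : R) : 1 < a -> a <= b -> J a <= J b.
Proof.
  intros Ha Hab.
  apply (nondecreasing_of_derive J (fun t => / (ln t)^2)); [assumption| |].
  - intros t Ht. apply is_derive_J; lra.
  - intros t Ht. pose proof (ln_pos t). left. apply Rinv_0_lt_compat, pow_lt. lra.
Qed.

(** * Partial summation *)

Lemma floor_nat (n : nat) (t : R) :
  INR n <= t < INR n + 1 -> Z.to_nat (Int_part t) = n.
Proof.
  intros [H1 H2]. rewrite <- (Int_part_spec t (Z.of_nat n)).
  - apply Nat2Z.id.
  - rewrite <- INR_IZR_INZ. lra.
Qed.

Lemma primes_upto_floor (n : nat) (t : R) :
  INR n <= t < INR n + 1 -> primes_upto t = primes_upto (INR n).
Proof.
  intros H. unfold primes_upto.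
  rewrite (floor_nat n t H), (floor_nat n (INR n)) by lra. reflexivity.
Qed.

Lemma theta_floor (n : nat) (t : R) :
  INR n <= t < INR n + 1 -> theta t = theta (INR n).
Proof. intros H. unfold theta. now rewrite (primes_upto_floor n t H). Qed.

Lemma fold_right_Rplus_snoc (l : list R) (x : R) :
  fold_right Rplus 0 (l ++ x :: nil) = fold_right Rplus 0 l + x.
Proof. induction l as [|y l IH]; simpl; [|rewrite IH]; ring. Qed.

(** The right endpoint is included because the jumps cancel there: if [n + 1] is
    prime, [pi] increases by 1 and [theta / ln] by [ln (n + 1) / ln (n + 1)]. *)
Lemma pi_sub_theta_div_ln_unit (n : nat) (t : R) :
  (1 <= n)%nat -> INR n <= t <= INR n + 1 ->
  prime_pi t - theta t / ln t = prime_pi (INR n) - theta (INR n) / ln t.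
Proof.
  intros Hn [H1 H2].
  destruct (Rlt_dec t (INR n + 1)) as [Hlt|Hge].
  - unfold prime_pi, theta. rewrite (primes_upto_floor n t) by lra. reflexivity.
  - replace t with (INR (S n)) by (rewrite S_INR; lra).
    assert (Hl : 0 < ln (INR (S n))).
    { apply ln_pos. rewrite S_INR. apply le_INR in Hn. simpl in Hn. lra. }
    unfold prime_pi, theta, primes_upto.
    rewrite (floor_nat (S n) (INR (S n))), (floor_nat n (INR n)) by lra.
    rewrite seq_S, filter_app. simpl (1 + n)%nat. cbn [filter].
    destruct (prime_dec (Z.of_nat (S n))).
    + rewrite length_app, map_app. cbn [map length].
      rewrite fold_right_Rplus_snoc, plus_INR. simpl (INR 1). field. lra.
    + now rewrite app_nil_r.
Qed.

(** This is [pi x - Li x - (theta x - x) / ln x], grouped so that [pi - theta / ln]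
    and the smooth part [J] are separate. *)
Definition abel_rest (t : R) : R := prime_pi t - theta t / ln t - J t.

Lemma theta_close (eps a t : R) :
  0 < a -> admissible_num_bound E_theta eps a -> a <= t ->
  - eps <= (theta t - t) / t <= eps.
Proof.
  intros Ha H Ht. specialize (H t Ht). unfold E_theta in H.
  now apply Rabs_le_between in H.
Qed.

(** On [[n, n+1]], with [A] and [T] the values of [pi] and [theta] at [n], the
    remainder is the smooth function [A - T / ln t - J t], with derivative
    [((T - t) / t) / (ln t)^2]; the bound on [E_theta] makes
    [eps * J + abel_rest] and [eps * J - abel_rest] both nondecreasing. *)
Lemma abel_rest_variation_unit (n : nat) (eps a b : R) :
  (1 <= n)%nat -> 1 < a -> INR n <= a -> a <= b -> b <= INR n + 1 ->
  admissible_num_bound E_theta eps a ->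
  Rabs (abel_rest b - abel_rest a) <= eps * (J b - J a).
Proof.
  intros Hn Ha1 Ha Hab Hb HE.
  set (A := prime_pi (INR n)). set (T := theta (INR n)).
  assert (HW : forall t, a <= t <= b -> abel_rest t = A - T / ln t - J t).
  { intros t Ht. unfold abel_rest.
    rewrite (pi_sub_theta_div_ln_unit n t Hn) by lra. reflexivity. }
  (* [s] is the sign in front of the remainder. *)
  assert (Hmono : forall s, s = 1 \/ s = -1 ->
    eps * J a + s * (A - T / ln a - J a) <= eps * J b + s * (A - T / ln b - J b)).
  { intros s Hs.
    apply (nondecreasing_of_derive
             (fun t => eps * J t + s * (A - T / ln t - J t))
             (fun t => (eps + s * ((T - t) / t)) * / (ln t)^2)); [assumption| |].
    - intros t Ht. assert (Hl : 0 < ln t) by (apply ln_pos; lra).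
      assert (HJ : is_derive J t (/ (ln t)^2)) by (apply is_derive_J; lra).
      auto_derive.
      + repeat split; try lra; eexists; exact HJ.
      + replace (Derive (fun x => J x) t) with (/ (ln t)^2)
          by (symmetry; apply is_derive_unique, HJ).
        field. lra.
    - intros t Ht. assert (Hl : 0 < ln t) by (apply ln_pos; lra).
      pose proof (theta_close eps a t ltac:(lra) HE ltac:(lra)) as Hth.
      rewrite (theta_floor n t) in Hth by lra. fold T in Hth.
      apply Rmult_le_pos.
      + destruct Hs as [-> | ->]; lra.
      + left. apply Rinv_0_lt_compat, pow_lt, Hl. }
  rewrite !HW by lra.
  pose proof (Hmono 1 (or_introl eq_refl)).
  pose proof (Hmono (-1) (or_intror eq_refl)).
  apply Rabs_le. lra.
Qed.

Lemma admissible_num_bound_le (E : R -> R) (eps a b : R) :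
  a <= b -> admissible_num_bound E eps a -> admissible_num_bound E eps b.
Proof. intros Hab H x Hx. apply H. lra. Qed.

Lemma abel_rest_variation (eps a b : R) :
  1 < a -> a <= b -> admissible_num_bound E_theta eps a ->
  Rabs (abel_rest b - abel_rest a) <= eps * (J b - J a).
Proof.
  intros Ha Hab HE.
  (* Induction on the number [k] of unit intervals starting from [n] that are
     needed to cover [[a, b]]. *)
  assert (Hk : forall (k n : nat) (a : R), (1 <= n)%nat -> 1 < a -> a <= b ->
    INR n <= a -> b <= INR n + INR k -> admissible_num_bound E_theta eps a ->
    Rabs (abel_rest b - abel_rest a) <= eps * (J b - J a)).
  { clear a Ha Hab HE.
    induction k as [|k IH]; intros n a Hn Ha Hab Hna Hb HE.
    - simpl in Hb. replace b with a by lra.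
      rewrite !Rminus_diag, Rabs_R0. lra.
    - rewrite S_INR in Hb.
      destruct (Rle_dec b (INR n + 1)) as [Hb1|Hb1].
      { now apply (abel_rest_variation_unit n). }
      assert (Hn1 : 1 <= INR n) by (apply le_INR in Hn; exact Hn).
      destruct (Rle_dec (INR n + 1) a) as [Ha1|Ha1].
      { apply (IH (S n) a); rewrite ?S_INR; auto with arith; lra. }
      pose proof (abel_rest_variation_unit n eps a (INR n + 1) Hn Ha Hna
        ltac:(lra) ltac:(lra) HE) as V1.
      pose proof (IH (S n) (INR n + 1) ltac:(lia) ltac:(lra) ltac:(lra)
        ltac:(rewrite S_INR; lra) ltac:(rewrite S_INR; lra)
        (admissible_num_bound_le E_theta eps a (INR n + 1) ltac:(lra) HE)) as V2.
      pose proof (Rabs_triang (abel_rest b - abel_rest (INR n + 1))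
                              (abel_rest (INR n + 1) - abel_rest a)) as Htri.
      replace (abel_rest b - abel_rest (INR n + 1)
               + (abel_rest (INR n + 1) - abel_rest a))
        with (abel_rest b - abel_rest a) in Htri by ring.
      lra. }
  destruct (nfloor_ex a) as [n Hn]; [lra|].
  destruct (nfloor_ex (b - INR n)) as [k Hk']; [lra|].
  apply (Hk (S k) n a); try lra; try assumption.
  - destruct n; [simpl in Hn; lra | lia].
  - rewrite S_INR. lra.
Qed.

Lemma abel_rest_variation_partition (N : nat) (b eps : nat -> R) :
  (1 <= N)%nat -> 0 < b 1%nat ->
  (forall i : nat, (1 <= i < N)%nat -> b i <= b (i + 1)%nat) ->
  (forall i : nat, (1 <= i <= N)%nat ->
     admissible_num_bound E_theta (eps i) (exp (b i))) ->
  Rabs (abel_rest (exp (b N)) - abel_rest (exp (b 1%nat)))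
  <= sum_n_m (fun i => eps i * (J (exp (b (i + 1)%nat)) - J (exp (b i))))
       1 (N - 1).
Proof.
  intros HN Hb1 Hmono Heps.
  assert (H : forall k, (k < N)%nat -> 0 < b (S k) /\
    Rabs (abel_rest (exp (b (S k))) - abel_rest (exp (b 1%nat)))
    <= sum_n_m (fun i => eps i * (J (exp (b (i + 1)%nat)) - J (exp (b i)))) 1 k).
  { induction k as [|k IH]; intros Hk.
    - split; [assumption|].
      rewrite sum_n_m_zero by lia. rewrite Rminus_diag, Rabs_R0. apply Rle_refl.
    - destruct IH as [IH1 IH2]; [lia|].
      assert (Hstep : b (S k) <= b (S (S k))).
      { replace (S (S k)) with (S k + 1)%nat by lia. apply Hmono. lia. }
      split; [lra|].
      rewrite sum_n_Sm by lia.
      replace (S k + 1)%nat with (S (S k)) by lia.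
      unfold plus; simpl AbelianGroup.sort in *; simpl.
      pose proof (abel_rest_variation (eps (S k)) (exp (b (S k))) (exp (b (S (S k))))
        ltac:(rewrite <- exp_0; now apply exp_increasing)
        ltac:(now apply exp_le_mono) (Heps (S k) ltac:(lia))) as V.
      pose proof (Rabs_triang (abel_rest (exp (b (S (S k)))) - abel_rest (exp (b (S k))))
                    (abel_rest (exp (b (S k))) - abel_rest (exp (b 1%nat)))) as Htri.
      match type of Htri with Rabs ?u <= _ =>
        replace u with (abel_rest (exp (b (S (S k)))) - abel_rest (exp (b 1%nat)))
          in Htri by ring end.
      lra. }
  destruct N as [|k]; [lia|].
  replace (S k - 1)%nat with k by lia. apply H. lia.
Qed.

(** With [eps <= 0] one would have [theta t = t] for all [t >= a], but [theta] is
    constant between consecutive integers.  This is what allows cancelling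
    [eps x1] against its inverse in [S_num]. *)
Lemma admissible_num_bound_E_theta_pos (eps a : R) :
  0 < a -> admissible_num_bound E_theta eps a -> 0 < eps.
Proof.
  intros Ha H.
  destruct (nfloor_ex (a + 1)) as [n Hn]; [lra|].
  pose proof (theta_close eps a (INR n) Ha H ltac:(lra)) as H1.
  pose proof (theta_close eps a (INR n + /2) Ha H ltac:(lra)) as H2.
  rewrite (theta_floor n (INR n + /2)) in H2 by lra.
  assert (Hz : forall t x, 0 < t -> eps <= 0 -> - eps <= (x - t) / t <= eps -> x = t).
  { intros t x Ht He Hx.
    assert (Hq : (x - t) / t = 0) by lra.
    apply Rminus_diag_uniq.
    replace (x - t) with ((x - t) / t * t) by (field; lra). rewrite Hq. ring. }
  destruct (Rlt_dec 0 eps) as [|He]; [assumption|exfalso].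
  pose proof (Hz (INR n) (theta (INR n)) ltac:(lra) ltac:(lra) H1).
  pose proof (Hz (INR n + /2) (theta (INR n)) ltac:(lra) ltac:(lra) H2).
  lra.
Qed.

(** * Monotonicity of the contribution beyond x1 *)

(** The value that [J y - J x1] must have for [y] to be a stationary point of
    [y |-> (ln y / y) (J y - J x1)]; below it, that function increases. *)
Definition stationary_gap (y : R) : R := y / (ln y * (ln y - 1)).

Lemma is_derive_stationary_gap_sub_J (y : R) :
  1 < ln y -> is_derive (fun t => stationary_gap t - J t) y (- / (ln y * (ln y - 1)^2)).
Proof.
  intros Hl.
  assert (Hy : 1 < y).
  { apply ln_lt_inv; [lra| |rewrite ln_1; lra].
    destruct (Rlt_dec 0 y) as [|Hn]; [assumption|].
    unfold ln in Hl. destruct (Rlt_dec 0 y); [contradiction|lra]. }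
  pose proof (is_derive_J y Hy) as HJ.
  unfold stationary_gap. auto_derive.
  - repeat split; try lra; try (eexists; exact HJ).
    apply Rgt_not_eq, Rmult_lt_0_compat; lra.
  - replace (Derive (fun x => J x) y) with (/ (ln y)^2)
      by (symmetry; apply is_derive_unique, HJ).
    field. lra.
Qed.

Lemma stationary_gap_sub_J_antitone (a b : R) :
  0 < a -> 1 < ln a -> a <= b -> stationary_gap b - J b <= stationary_gap a - J a.
Proof.
  intros Ha Hl Hab.
  apply Ropp_le_cancel.
  assert (Hl' : forall t, a <= t <= b -> 1 < ln t).
  { intros t Ht. pose proof (ln_le_mono a t Ha (proj1 Ht)). lra. }
  apply (nondecreasing_of_derive (fun t => - (stationary_gap t - J t))
           (fun t => - - / (ln t * (ln t - 1)^2))); [assumption| |].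
  - intros t Ht. apply @is_derive_opp, is_derive_stationary_gap_sub_J, Hl', Ht.
  - intros t Ht. specialize (Hl' t ltac:(lra)). rewrite Ropp_involutive. left.
    apply Rinv_0_lt_compat, Rmult_lt_0_compat; [lra|apply pow_lt; lra].
Qed.

Lemma J_increment_le (a b : R) :
  1 < a -> a <= b -> J b - J a <= (b - a) / (ln a)^2.
Proof.
  intros Ha Hab. pose proof (ln_pos a Ha) as Hl.
  assert (H : a / (ln a)^2 - J a <= b / (ln a)^2 - J b).
  { apply (nondecreasing_of_derive (fun t => t / (ln a)^2 - J t)
             (fun t => / (ln a)^2 - / (ln t)^2)); [assumption| |].
    - intros t Ht. apply @is_derive_minus; [|apply is_derive_J; lra].
      auto_derive; [nra|]. field. lra.
    - intros t Ht. apply (proj1 (Rminus_le_0 _ _)), Rinv_le_contravar; [now apply pow_lt|].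
      apply pow_incr. split; [lra|]. apply ln_le_mono; lra. }
  unfold Rdiv in *. lra.
Qed.

(** With [L = ln x] and [l = ln L <= 1], the crude bound [x (L - 1) / L^2] for the
    left side suffices, since [(L - 1) (L + l) (L + l - 1) <= (L - 1) (L + 1) L],
    which is at most [L^3]. *)
Lemma J_gap_le_stationary_small (x : R) :
  0 < x -> 1 < ln x -> ln x <= exp 1 -> J (x * ln x) - J x <= stationary_gap (x * ln x).
Proof.
  intros Hx HL HLe.
  assert (Hx1 : 1 < x) by (apply ln_lt_inv; [lra|lra|rewrite ln_1; lra]).
  eapply Rle_trans; [apply J_increment_le; [lra|nra]|].
  unfold stationary_gap. rewrite ln_mult by lra.
  set (L := ln x) in *.
  assert (Hl0 : 0 < ln L) by (now apply ln_pos).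
  assert (Hl1 : ln L <= 1).
  { rewrite <- (ln_exp 1). apply ln_le_mono; lra. }
  set (l := ln L) in *.
  apply Rle_trans with (x * L / ((L + 1) * L)).
  - apply (proj2 (Rminus_le_0 _ _)).
    replace (x * L / ((L + 1) * L) - (x * L - x) / L ^ 2)
      with (x / (L ^ 2 * (L + 1))) by (field; lra).
    apply Rlt_le, Rdiv_lt_0_compat; [lra|].
    apply Rmult_lt_0_compat; [apply pow_lt|]; lra.
  - apply Rmult_le_compat_l; [nra|].
    apply Rinv_le_contravar; nra.
Qed.

(** For [L = ln x >= e], the difference of the two sides is nondecreasing in [x]:
    with [M = L + ln L], its derivative is [1 / L^2 - (L + 1) / (M (M - 1)^2)],
    which is nonnegative because [M >= L + 1].  At [x = exp e], where [L = e], the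
    previous lemma applies. *)
Lemma J_gap_le_stationary (x : R) :
  0 < x -> 1 < ln x -> J (x * ln x) - J x <= stationary_gap (x * ln x).
Proof.
  intros Hx HL.
  destruct (Rle_dec (ln x) (exp 1)) as [Hs|Hb]; [now apply J_gap_le_stationary_small|].
  apply Rnot_le_lt in Hb.
  pose proof (exp_ineq1 1 ltac:(lra)) as He.
  set (x' := exp (exp 1)).
  assert (Hx' : x' <= x).
  { unfold x'. rewrite <- (exp_ln x Hx). left. now apply exp_increasing. }
  assert (H0 : J (x' * ln x') - J x' <= stationary_gap (x' * ln x')).
  { apply J_gap_le_stationary_small; unfold x'; rewrite ?ln_exp; try lra. apply exp_pos. }
  assert (Hx'0 : 0 < x') by apply exp_pos.
  set (D := fun t => (fun y => stationary_gap y - J y) (t * ln t) + J t).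
  cut (D x' <= D x); [unfold D; lra|].
  apply (nondecreasing_of_derive D (fun t =>
    (ln t + 1) * (- / ((ln t + ln (ln t)) * (ln t + ln (ln t) - 1)^2)) + / (ln t)^2));
    [assumption| |].
  - intros t Ht.
    assert (Hlt : exp 1 <= ln t).
    { rewrite <- (ln_exp (exp 1)). apply ln_le_mono; [assumption|tauto]. }
    assert (Ht1 : 1 < t) by (apply ln_lt_inv; [lra|lra|rewrite ln_1; lra]).
    assert (Hll : 0 < ln (ln t)) by (apply ln_pos; lra).
    unfold D. apply @is_derive_plus; [|now apply is_derive_J].
    apply (is_derive_comp (fun y => stationary_gap y - J y) (fun t => t * ln t)).
    + rewrite <- (ln_mult t (ln t)) by lra.
      apply is_derive_stationary_gap_sub_J. rewrite ln_mult; lra.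
    + auto_derive; [lra|]. field. lra.
  - intros t Ht.
    assert (Hlt : exp 1 <= ln t).
    { rewrite <- (ln_exp (exp 1)). apply ln_le_mono; [assumption|fold x'; lra]. }
    assert (Hll : 1 <= ln (ln t)).
    { rewrite <- (ln_exp 1). apply ln_le_mono; [apply exp_pos|assumption]. }
    set (L := ln t) in *. set (l := ln L) in *.
    assert (Hc : / ((L + l) * (L + l - 1)^2) <= / ((L + 1) * L^2)).
    { apply Rinv_le_contravar.
      - apply Rmult_lt_0_compat; [lra|apply pow_lt; lra].
      - apply Rmult_le_compat; [lra|apply pow2_ge_0|lra|].
        apply pow_incr. lra. }
    apply (Rmult_le_compat_l (L + 1)) in Hc; [|lra].
    replace ((L + 1) * / ((L + 1) * L^2)) with (/ L^2) in Hc by (field; lra).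
    lra.
Qed.

(** The normalised integral of [1 / ln^2] over [[x1, x]]: what the interval beyond
    the last partition point contributes to [E_pi x / eps x1]. *)
Definition tail_mass (x1 x : R) : R := ln x / x * (J x - J x1).

Lemma is_derive_scaled_sub_J (c t : R) :
  1 < t -> is_derive (fun t => c * (t / ln t) - J t) t
             ((c * (ln t - 1) - 1) / (ln t)^2).
Proof.
  intros Ht. pose proof (is_derive_J t Ht) as HJ. pose proof (ln_pos t Ht).
  auto_derive.
  - repeat split; try lra. eexists; exact HJ.
  - replace (Derive (fun x => J x) t) with (/ (ln t)^2)
      by (symmetry; apply is_derive_unique, HJ).
    field. lra.
Qed.

(** Bounding [tail_mass] by [c] amounts to bounding [c * (x / ln x) - J x] from
    below by [- J x1]; the derivative of the latter function has the sign of
    [c * (ln x - 1) - 1], which changes only once. *)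
Lemma tail_mass_le_iff (x1 x c : R) :
  1 < x -> tail_mass x1 x <= c <-> J x - J x1 <= c * (x / ln x).
Proof.
  intros Hx. pose proof (ln_pos x Hx) as Hl. unfold tail_mass.
  assert (Hq : 0 < ln x / x) by (apply Rdiv_lt_0_compat; lra).
  assert (Hq' : 0 < x / ln x) by (apply Rdiv_lt_0_compat; lra).
  assert (Hone : ln x / x * (x / ln x) = 1) by (field; lra).
  split; intros H.
  - apply (Rmult_le_compat_r (x / ln x)) in H; [|lra].
    replace (ln x / x * (J x - J x1) * (x / ln x))
      with ((ln x / x * (x / ln x)) * (J x - J x1)) in H by ring.
    rewrite Hone in H. lra.
  - apply (Rmult_le_compat_l (ln x / x)) in H; [|lra].
    replace (ln x / x * (c * (x / ln x))) with (ln x / x * (x / ln x) * c) in H by ring.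
    rewrite Hone in H. lra.
Qed.

Lemma scaled_sub_J_antitone (c x z : R) :
  0 < c -> 1 < x -> x <= z -> c * (ln z - 1) <= 1 ->
  c * (z / ln z) - J z <= c * (x / ln x) - J x.
Proof.
  intros Hc Hx Hxz Hcz. apply Ropp_le_cancel.
  apply (nondecreasing_of_derive (fun t => - (c * (t / ln t) - J t))
           (fun t => - ((c * (ln t - 1) - 1) / (ln t)^2))); [assumption| |].
  - intros t Ht. apply @is_derive_opp, is_derive_scaled_sub_J. lra.
  - intros t Ht. pose proof (ln_le_mono t z ltac:(lra) ltac:(lra)).
    pose proof (ln_pos t ltac:(lra)).
    replace (- ((c * (ln t - 1) - 1) / (ln t)^2))
      with ((1 - c * (ln t - 1)) * / (ln t)^2) by (unfold Rdiv; ring).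
    apply Rmult_le_pos; [nra|]. left. now apply Rinv_0_lt_compat, pow_lt.
Qed.

Lemma scaled_sub_J_monotone (c z x : R) :
  0 < c -> 1 < z -> z <= x -> 1 <= c * (ln z - 1) ->
  c * (z / ln z) - J z <= c * (x / ln x) - J x.
Proof.
  intros Hc Hz Hzx Hcz.
  apply (nondecreasing_of_derive (fun t => c * (t / ln t) - J t)
           (fun t => (c * (ln t - 1) - 1) / (ln t)^2)); [assumption| |].
  - intros t Ht. apply is_derive_scaled_sub_J. lra.
  - intros t Ht. pose proof (ln_le_mono z t ltac:(lra) ltac:(lra)).
    pose proof (ln_pos t ltac:(lra)).
    apply Rmult_le_pos; [nra|]. left. now apply Rinv_0_lt_compat, pow_lt.
Qed.

Lemma stationary_gap_eq (y : R) : 1 < ln y -> stationary_gap y = 1 / (ln y - 1) * (y / ln y).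
Proof. intros. unfold stationary_gap. field. lra. Qed.

(** With [c = tail_mass x1 z], the function [c * (t / ln t) - J t] equals [- J x1]
    at [z], and it is nonincreasing up to [z] as soon as [c <= 1 / (ln z - 1)].
    That bound says [J z - J x1 <= stationary_gap z], which is inherited from
    the point [x1 * ln x1] since [stationary_gap - J] decreases. *)
Lemma tail_mass_le_at_later (x1 x z : R) :
  3 < x1 -> x1 <= x -> x <= z -> z <= x1 * ln x1 ->
  tail_mass x1 x <= tail_mass x1 z.
Proof.
  intros H1 Hx Hxz Hz.
  pose proof (ln_gt_1 x1 H1) as HL. pose proof (ln_gt_1 z ltac:(lra)) as HLz.
  pose proof (J_gap_le_stationary x1 ltac:(lra) HL) as Hgap.
  pose proof (stationary_gap_sub_J_antitone z (x1 * ln x1) ltac:(lra) HLz Hz) as Hanti.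
  assert (Hcz : tail_mass x1 z <= 1 / (ln z - 1)).
  { apply tail_mass_le_iff; [lra|]. rewrite <- stationary_gap_eq by lra. lra. }
  set (c := tail_mass x1 z) in *.
  assert (Hc0 : 0 <= c).
  { unfold c, tail_mass. apply Rmult_le_pos.
    - apply Rlt_le, Rdiv_lt_0_compat; lra.
    - pose proof (J_le x1 z). lra. }
  apply tail_mass_le_iff; [lra|].
  assert (Hcc : J z - J x1 <= c * (z / ln z)).
  { apply tail_mass_le_iff; [lra|]. apply Rle_refl. }
  assert (Hc1 : c * (ln z - 1) <= 1).
  { apply (Rmult_le_compat_r (ln z - 1)) in Hcz; [|lra].
    replace (1 / (ln z - 1) * (ln z - 1)) with 1 in Hcz by (field; lra). lra. }
  (* [c = 0] occurs when [z = x1]. *)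
  destruct Hc0 as [Hc0|Hc0].
  - pose proof (scaled_sub_J_antitone c x z Hc0 ltac:(lra) Hxz Hc1). lra.
  - rewrite <- Hc0 in *. pose proof (J_le x z). lra.
Qed.

(** For [y = x1 * ln x1] and [c = 1 / (ln y - 1)], the function
    [c * (t / ln t) - J t] decreases up to [y] and increases afterwards, and at [y]
    it is at least [- J x1] by [J_gap_le_stationary]. *)
Lemma tail_mass_le_const (x1 x : R) :
  3 < x1 -> x1 <= x ->
  tail_mass x1 x <= 1 / (ln x1 + ln (ln x1) - 1).
Proof.
  intros H1 Hx.
  pose proof (ln_gt_1 x1 H1) as HL.
  pose proof (J_gap_le_stationary x1 ltac:(lra) HL) as Hgap.
  set (y := x1 * ln x1) in *.
  assert (Hy : x1 <= y) by (unfold y; nra).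
  pose proof (ln_gt_1 y ltac:(lra)) as HLy.
  replace (ln x1 + ln (ln x1)) with (ln y) by (unfold y; apply ln_mult; lra).
  rewrite stationary_gap_eq in Hgap by lra.
  assert (Hc : 0 < 1 / (ln y - 1)) by (apply Rdiv_lt_0_compat; lra).
  assert (Hcy : 1 / (ln y - 1) * (ln y - 1) = 1) by (field; lra).
  set (c := 1 / (ln y - 1)) in *.
  apply tail_mass_le_iff; [lra|].
  destruct (Rle_dec x y) as [Hxy|Hxy].
  - pose proof (scaled_sub_J_antitone c x y Hc ltac:(lra) Hxy ltac:(lra)). lra.
  - pose proof (scaled_sub_J_monotone c y x Hc ltac:(lra) ltac:(lra) ltac:(lra)). lra.
Qed.

(** * The bound for E_pi *)

Lemma ln_div_antitone (x1 x : R) :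
  3 < x1 -> x1 <= x -> ln x / x <= ln x1 / x1.
Proof.
  intros H1 Hx. apply Ropp_le_cancel.
  apply (nondecreasing_of_derive (fun t => - (ln t / t))
           (fun t => (ln t - 1) / t^2)); [assumption| |].
  - intros t Ht. auto_derive; [lra|]. field. lra.
  - intros t Ht. pose proof (ln_gt_1 t ltac:(lra)).
    apply Rmult_le_pos; [lra|]. left. apply Rinv_0_lt_compat, pow_lt. lra.
Qed.

(** The common core of both definitions of [mu_num]: they differ only in how they
    bound [tail_mass x1 x]. *)
Lemma E_pi_le_sum (x0 x1 : R) (hx0 : 2 < x0) (hx1 : x0 <= x1) (h3 : 3 < x1)
  (N : nat) (b : nat -> R) (hb : is_partition N b (ln x0) (ln x1))
  (eps : R -> R)
  (heps : forall i : nat, (1 <= i <= N)%nat ->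
     admissible_num_bound E_theta (eps (exp (b i))) (exp (b i)))
  (x : R) (hx : x1 <= x) :
  E_pi x <= eps x1 * (1 + (S_num eps N b x0 x1 + tail_mass x1 x)).
Proof.
  destruct hb as [HN [Hb1 [HbN Hmono]]].
  assert (HE1 : admissible_num_bound E_theta (eps x1) x1).
  { specialize (heps N ltac:(lia)). now rewrite HbN, exp_ln in heps by lra. }
  pose proof (admissible_num_bound_E_theta_pos (eps x1) x1 ltac:(lra) HE1) as Heps.
  pose proof (ln_pos x0 ltac:(lra)) as HL0.
  pose proof (ln_gt_1 x1 h3) as HL1. pose proof (ln_gt_1 x ltac:(lra)) as HL.
  pose proof (abel_rest_variation_partition N b (fun i => eps (exp (b i))) HN
    ltac:(lra) Hmono heps) as Vp.
  rewrite Hb1, HbN, !exp_ln in Vp by lra.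
  pose proof (abel_rest_variation (eps x1) x1 x ltac:(lra) hx HE1) as V1.
  pose proof (HE1 x hx) as Hth. unfold E_theta in Hth.
  unfold S_num.
  rewrite (sum_n_m_ext _ (fun i => eps (exp (b i))
      * (J (exp (b (i + 1)%nat)) - J (exp (b i))))).
  2:{ intros i. unfold J. rewrite !ln_exp. simpl. ring. }
  set (Sg := sum_n_m _ 1 (N - 1)) in *.
  assert (HSg : 0 <= Sg) by (eapply Rle_trans; [apply Rabs_pos|exact Vp]).
  assert (HW0 : (prime_pi x0 - Li x0) / (x0 / ln x0) - (theta x0 - x0) / x0
                = ln x0 / x0 * abel_rest x0).
  { unfold abel_rest, J. field. lra. }
  rewrite HW0, Rabs_mult, (Rabs_pos_eq (ln x0 / x0))
    by (apply Rlt_le, Rdiv_lt_0_compat; lra).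
  assert (HWx : (prime_pi x - Li x) / (x / ln x)
    = (theta x - x) / x + ln x / x * (abel_rest x0
        + ((abel_rest x1 - abel_rest x0) + (abel_rest x - abel_rest x1)))).
  { unfold abel_rest, J. field. lra. }
  unfold E_pi. rewrite HWx.
  assert (Hq : 0 < ln x / x) by (apply Rdiv_lt_0_compat; lra).
  pose proof (ln_div_antitone x1 x h3 hx) as Hdec.
  eapply Rle_trans; [apply Rabs_triang|].
  rewrite Rabs_mult, (Rabs_pos_eq (ln x / x)) by lra.
  assert (HA : Rabs (abel_rest x0
        + ((abel_rest x1 - abel_rest x0) + (abel_rest x - abel_rest x1)))
      <= Rabs (abel_rest x0) + Sg + eps x1 * (J x - J x1)).
  { eapply Rle_trans; [apply Rabs_triang|].
    eapply Rle_trans; [apply Rplus_le_compat_l, Rabs_triang|]. lra. }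
  apply (Rmult_le_compat_l (ln x / x)) in HA; [|lra].
  pose proof (Rabs_pos (abel_rest x0)) as HW0p.
  assert (Hd2 : ln x / x * (Rabs (abel_rest x0) + Sg)
                <= ln x1 / x1 * (Rabs (abel_rest x0) + Sg)).
  { apply Rmult_le_compat_r; lra. }
  replace (eps x1 * _) with (eps x1 + ln x1 / x1 * (Rabs (abel_rest x0) + Sg)
    + ln x / x * (eps x1 * (J x - J x1))).
  - lra.
  - unfold tail_mass. field. lra.
Qed.

Theorem theorem6
  (x0 x1 : R) (hx0 : 2 < x0) (hx1 : Rmax x0 14 <= x1)
  (N : nat) (b : nat -> R) (hb : is_partition N b (ln x0) (ln x1))
  (eps : R -> R)
  (heps : forall i : nat, (1 <= i <= N)%nat ->
     admissible_num_bound E_theta (eps (exp (b i))) (exp (b i)))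
  (x2 : Rbar) (hx2 : Rbar_le (Finite x1) x2) :
  forall x : R, x1 <= x -> Rbar_le (Finite x) x2 ->
    E_pi x <= eps x1 * (1 + mu_num eps N b x0 x1 x2).
Proof.
  intros x Hx Hxx2.
  pose proof (Rmax_l x0 14). pose proof (Rmax_r x0 14).
  assert (Heps : 0 < eps x1).
  { destruct hb as [HN [_ [HbN _]]]. specialize (heps N ltac:(lia)).
    rewrite HbN, exp_ln in heps by lra.
    apply (admissible_num_bound_E_theta_pos (eps x1) x1); [lra|assumption]. }
  eapply Rle_trans; [apply (E_pi_le_sum x0 x1 hx0 ltac:(lra) ltac:(lra) N b hb eps heps x Hx)|].
  apply Rmult_le_compat_l; [lra|]. apply Rplus_le_compat_l.
  unfold mu_num. destruct (Rbar_le_dec x2 (Finite (x1 * ln x1))) as [Hle|Hgt].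
  - destruct x2 as [z| |]; simpl in *; [|contradiction|contradiction].
    apply Rplus_le_compat_l.
    replace (Li z - z / ln z - Li x1 + x1 / ln x1) with (J z - J x1)
      by (unfold J; ring).
    apply (tail_mass_le_at_later x1 x z); lra.
  - apply Rplus_le_compat_l, tail_mass_le_const; lra.
Qed.
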